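(* Let $k$ be a positive integer. (1) There are at most $\mathit{Tower}(k+\log^*k+3)$ pairwise inequivalent first-order sentences about graphs of quantifier depth $k$. (2) Every first-order sentence $\Phi$ about graphs of quantifier depth $k$ has an equivalent sentence $\Phi'$ with the same quantifier depth and length $L(\Phi')<3\,\mathit{Tower}(k+\log^*k+2)^2$.
   Context: Graphs are finite, simple, undirected, with non-empty vertex set. First-order sentences about graphs have variables ranging over vertices, relation symbols $\sim$ (adjacency) and $=$ (equality), Boolean connectives and quantifiers $\exists,\forall$. The quantifier depth is the maximum length of a chain of nested quantifiers; the length is the total number of symbols (each occurrence of a variable symbol contributes 1). Two sentences are equivalent if they are true on exactly the same graphs. $\mathit{Tower}(0)=1$, $\mathit{Tower}(i)=2^{\mathit{Tower}(i-1)}$; $\log^*n=\min\{i:\mathit{Tower}(i)\ge n\}$. *)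

(* Defs.v *)
From mathcomp Require Import all_boot.

Set Implicit Arguments.
Unset Strict Implicit.
Unset Printing Implicit Defensive.

Record graph := Graph {
  vertex :> finType;
  adj : rel vertex;
  adj_sym : symmetric adj;
  adj_irrefl : irreflexive adj;
  vertex_nonempty : 0 < #|vertex|
}.

(* The natural numbers name the countably many variable symbols. *)
Inductive formula : Type :=
| FAdj of nat & nat
| FEq of nat & nat
| FNot of formula
| FAnd of formula & formula
| FOr of formula & formula
| FImp of formula & formula
| FIff of formula & formula
| FEx of nat & formula
| FAll of nat & formula.

Fixpoint free_vars (phi : formula) : seq nat :=
  match phi with
  | FAdj x y | FEq x y => [:: x; y]
  | FNot f => free_vars f
  | FAnd f g | FOr f g | FImp f g | FIff f g => free_vars f ++ free_vars g
  | FEx x f | FAll x f => [seq y <- free_vars f | y != x]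
  end.

Definition sentence (phi : formula) : Prop := free_vars phi = [::].

Fixpoint qdepth (phi : formula) : nat :=
  match phi with
  | FAdj _ _ | FEq _ _ => 0
  | FNot f => qdepth f
  | FAnd f g | FOr f g | FImp f g | FIff f g => maxn (qdepth f) (qdepth g)
  | FEx _ f | FAll _ f => (qdepth f).+1
  end.

(* Number of symbols in the fully parenthesized notation
     x~y   x=y   ~f   (f /\ g)   (f \/ g)   (f -> g)   (f <-> g)   Ex f   Ax f,
   so a binary connective accounts for itself and for one pair of parentheses. *)
Fixpoint flength (phi : formula) : nat :=
  match phi with
  | FAdj _ _ | FEq _ _ => 3
  | FNot f => 1 + flength f
  | FAnd f g | FOr f g | FImp f g | FIff f g => 3 + flength f + flength g
  | FEx _ f | FAll _ f => 2 + flength f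
  end.

Definition upd (T : Type) (v : nat -> T) (x : nat) (a : T) : nat -> T :=
  fun y => if y == x then a else v y.

Fixpoint sat (G : graph) (phi : formula) (v : nat -> G) : bool :=
  match phi with
  | FAdj x y => adj (v x) (v y)
  | FEq x y => v x == v y
  | FNot f => ~~ sat f v
  | FAnd f g => sat f v && sat g v
  | FOr f g => sat f v || sat g v
  | FImp f g => sat f v ==> sat g v
  | FIff f g => sat f v == sat g v
  | FEx x f => [exists a : G, sat f (upd v x a)]
  | FAll x f => [forall a : G, sat f (upd v x a)]
  end.

(* The value of a sentence does not depend on the assignment, and assignments
   exist because the vertex set is non-empty. *)
Definition models (G : graph) (phi : formula) : Prop :=
  forall v : nat -> G, sat phi v.

Definition equivalent (phi psi : formula) : Prop :=
  forall G : graph, models G phi <-> models G psi.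

Fixpoint tower (i : nat) : nat := if i is j.+1 then 2 ^ tower j else 1.

Lemma leq_tower n : n <= tower n.
Proof. by elim: n => //= n IHn; apply: leq_ltn_trans IHn (ltn_expl _ _). Qed.

Lemma ex_tower n : exists i, n <= tower i.
Proof. by exists n; apply: leq_tower. Qed.

Definition logstar (n : nat) : nat := ex_minn (ex_tower n).

(* Main.v *)
(** Call sign pattern of a finite list of formulas any conjunction choosing, for
    each formula of the list, either it or its negation.  Starting from the
    atoms in [k] variables and repeatedly quantifying away one variable in all
    the sign patterns, one obtains after [i] rounds a list [basis k i] of
    formulas of depth at most [i] in [k - i] free variables; by back and forth,
    agreement on [basis k i] forces agreement on all formulas of depth at most
    [i].  Hence a sentence of depth [k] is a disjunction of sign patterns of
    [basis k k].  Each round exponentiates the size of the list, which is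
    [k * (k - 1) <= 2 ^ k] at the start, and this growth dwarfs that of the
    lengths of the formulas. *)
Require Import Defs.
From HB Require Import structures.
From mathcomp Require Import all_boot.
From mathcomp Require Import zify.
From Stdlib Require Import Classical.

Set Implicit Arguments.
Unset Strict Implicit.
Unset Printing Implicit Defensive.

Lemma formula_comparable : comparable formula.
Proof. by move=> f g; rewrite /decidable; decide equality; apply: eq_comparable. Qed.

HB.instance Definition _ := hasDecEq.Build formula (compareP formula_comparable).

(** * Sign patterns *)

(** The syntax has no truth constant, so [T] closes each conjunction; a chosen [T] also pads the
    quantifier depth. *)
Fixpoint patterns (T : formula) (B : seq formula) : seq formula :=
  if B is b :: B' then
    [seq FAnd b t | t <- patterns T B']
      ++ [seq FAnd (FNot b) t | t <- patterns T B']
  else [:: T].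

Lemma size_patterns T B : size (patterns T B) = 2 ^ size B.
Proof.
by elim: B => //= b B IH; rewrite size_cat !size_map IH expnS mul2n addnn.
Qed.

Lemma patterns_all (P : pred formula) T (B : seq formula) :
  P T -> {in B, forall b t, P t -> P (FAnd b t) && P (FAnd (FNot b) t)} ->
  {in patterns T B, forall t, P t}.
Proof.
move=> PT; elim: B => [|b B IH] PB t /=; first by rewrite inE => /eqP->.
have{}IH : {in patterns T B, forall t, P t}.
  by apply: IH => c cB; apply: PB; rewrite inE cB orbT.
by rewrite mem_cat => /orP[] /mapP[u /IH Pu ->];
  have /andP[] := PB b (mem_head _ _) u Pu.
Qed.

Lemma patterns_exist (G : graph) (v : nat -> G) T B :
  sat T v -> exists2 t, t \in patterns T B & sat t v.
Proof.
move=> satT; elim: B => [|b B [t tB satt]] /=.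
  by exists T; rewrite ?mem_head.
case satb: (sat b v).
  by exists (FAnd b t); rewrite /= ?satb // mem_cat map_f.
by exists (FAnd (FNot b) t); rewrite /= ?satb // mem_cat map_f ?orbT.
Qed.

Definition agree (G G' : graph) (B : seq formula) (v : nat -> G) (v' : nat -> G') :=
  {in B, forall b, sat b v = sat b v'}.

Lemma agree_sym (G G' : graph) B (v : nat -> G) (v' : nat -> G') :
  agree B v v' -> agree B v' v.
Proof. by move=> vv' b /vv'. Qed.

(** A pattern contains each member of [B] or its negation, so its truth fixes all their values. *)
Lemma patterns_agree (G G' : graph) T B t (v : nat -> G) (v' : nat -> G') :
  t \in patterns T B -> sat t v -> sat t v' -> agree B v v'.
Proof.
elim: B t => [|b B IH] t //=; rewrite mem_cat.
by case/orP=> /mapP[u uB ->] /= /andP[bv uv] /andP[bv' uv'] c;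
  rewrite inE => /predU1P[->|/(IH u uB uv uv')//];
  [rewrite bv bv' | rewrite (negPf bv) (negPf bv')].
Qed.

(** A tautology of depth exactly [i], closed once [i] is positive; it lets normal forms have depth
    exactly [k]. *)
Definition verum (i : nat) : formula := iter i (FEx 0) (FEq 0 0).

Lemma sat_verum (G : graph) i (v : nat -> G) : sat (verum i) v.
Proof.
by elim: i v => [|i IH] v /=; [exact: eqxx | apply/existsP; exists (v 0)].
Qed.

Lemma qdepth_verum i : qdepth (verum i) = i.
Proof. by elim: i => //= i ->. Qed.

Lemma flength_verum i : flength (verum i) = 2 * i + 3.
Proof. by elim: i => //= i ->; lia. Qed.

Lemma free_vars_verum i : free_vars (verum i) = if i is 0 then [:: 0; 0] else [::].
Proof. by elim: i => //= -[|i] //= ->. Qed.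

(** A conjunct costs at most [e], plus 3 for [FAnd] and 1 for a negation. *)
Lemma flength_patterns T (B : seq formula) e :
  {in B, forall b, flength b <= e} ->
  {in patterns T B, forall t, flength t <= size B * (e + 4) + flength T}.
Proof.
elim: B => [|b B IH] Be t /=; first by rewrite inE => /eqP->.
have be : flength b <= e by apply: Be; apply: mem_head.
have{}IH : {in patterns T B, forall t, flength t <= size B * (e + 4) + flength T}.
  by apply: IH => c cB; apply: Be; rewrite inE cB orbT.
by rewrite mem_cat mulSn => /orP[] /mapP[u /IH uB ->] /=; lia.
Qed.

Definition well_scoped (d n : nat) (f : formula) : bool :=
  (qdepth f <= d) && all (fun x => x < n) (free_vars f).

Lemma well_scoped_verum i k : i <= k -> 0 < k -> well_scoped i (k - i) (verum i).
Proof.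
rewrite /well_scoped qdepth_verum leqnn free_vars_verum.
by case: i => //= _ k0; rewrite subn0 k0.
Qed.

Lemma well_scoped_patterns d n T (B : seq formula) :
  well_scoped d n T -> {in B, forall b, well_scoped d n b} ->
  {in patterns T B, forall t, well_scoped d n t}.
Proof.
move=> wT wB; apply: patterns_all => // b /wB /andP[bd bn] t /andP[td tn].
by rewrite /well_scoped /= geq_max bd td all_cat bn tn.
Qed.

(** * The bases *)

(** Only [y < x] is listed: adjacency and equality are symmetric, and their values on the diagonal
    are fixed. *)
Definition pairs (F : nat -> nat -> formula) (k : nat) : seq formula :=
  [seq F x y | x <- iota 0 k, y <- iota 0 x].

Fixpoint basis (k i : nat) : seq formula :=
  if i is j.+1 then
    [seq FEx (k - i) t | t <- patterns (verum j) (basis k j)]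
  else pairs FAdj k ++ pairs FEq k.

Lemma pairsP F k f :
  reflect (exists x y, y < x < k /\ f = F x y) (f \in pairs F k).
Proof.
apply: (iffP allpairsPdep) => [[x [y [xk yx ->]]]|[x [y [/andP[yx xk] ->]]]];
  exists x, y; first by move: xk yx; rewrite !mem_iota !add0n /= => -> ->.
by rewrite !mem_iota.
Qed.

Lemma well_scoped_basis k i :
  i <= k -> 0 < k -> {in basis k i, forall b, well_scoped i (k - i) b}.
Proof.
move=> + k0; elim: i => [_|i IH ik] b /=.
  rewrite mem_cat subn0 => /orP[] /pairsP[x [y [/andP[yx xk] ->]]];
    by rewrite /well_scoped /= xk (ltn_trans yx xk).
case/mapP=> t tB ->.
have /andP[td tn] : well_scoped i (k - i) t.
  apply: well_scoped_patterns tB; first exact: well_scoped_verum (ltnW ik) k0.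
  by apply: IH; apply: ltnW.
rewrite /well_scoped /= ltnS td /= all_filter; apply: sub_all tn => x /= xk.
by apply/implyP; lia.
Qed.

(** Some pattern holds after moving pebble [k - i.+1] to [a]. Its existential closure lies in the
    next basis, hence transfers to [v'] and yields [a']. *)
Lemma basis_back_forth (G G' : graph) k i (v : nat -> G) (v' : nat -> G') a :
  agree (basis k i.+1) v v' ->
  exists a', agree (basis k i) (upd v (k - i.+1) a) (upd v' (k - i.+1) a').
Proof.
move=> vv'; have [t tB satt] :=
  patterns_exist (basis k i) (sat_verum i (upd v (k - i.+1) a)).
have : sat (FEx (k - i.+1) t) v by apply/existsP; exists a.
rewrite vv' => [/existsP[a' satt']|]; last exact: map_f.
by exists a'; apply: patterns_agree tB satt satt'.
Qed.

Lemma agree_atoms (G G' : graph) k i (v : nat -> G) (v' : nat -> G') x y :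
  i <= k -> agree (basis k i) v v' -> x < k - i -> y < k - i ->
  (adj (v x) (v y) = adj (v' x) (v' y)) * ((v x == v y) = (v' x == v' y)).
Proof.
elim: i v v' => [|i IH] v v' ik vv' xk yk.
  wlog yx : x y xk yk / y <= x => [hw|].
    have [/(hw x y xk yk)//|/ltnW /(hw y x yk xk)] := leqP y x.
    by rewrite (adj_sym (v x)) (adj_sym (v' x)) (eq_sym (v x)) (eq_sym (v' x)).
  move: yx; rewrite leq_eqVlt => /predU1P[->|yx]; first by rewrite !adj_irrefl !eqxx.
  rewrite subn0 in xk yk.
  by split; [apply: (vv' (FAdj x y)) | apply: (vv' (FEq x y))];
    rewrite mem_cat; apply/orP; [left | right]; apply/pairsP; exists x, y; rewrite yx.
(* Any vertex would do: pebble [k - i.+1] is neither [x] nor [y], so moving it only serves to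
   descend to the atoms. *)
have [a' uu'] := basis_back_forth (v x) vv'.
have := IH _ _ (ltnW ik) uu'.
by rewrite /upd; move=> /(_ ltac:(lia) ltac:(lia)); rewrite !ltn_eqF.
Qed.

(* [w] and [w'] interpret the variables of [f] by the pebbles [v] and [v'],
   so that [f] need not use the variable names of the basis. *)
Lemma agree_sat (G G' : graph) k f i (v w : nat -> G) (v' w' : nat -> G') :
  qdepth f <= i <= k -> agree (basis k i) v v' ->
  {in free_vars f, forall x, exists j, [/\ j < k - i, w x = v j & w' x = v' j]} ->
  sat f w = sat f w'.
Proof.
(* The bound variable takes the new pebble [k - l.+1]; the other variables keep their pebbles, all
   of smaller index. *)
have quant x g (H H' : graph) l (u z : nat -> H) (u' z' : nat -> H') a a' :
    l < k ->
    {in free_vars (FEx x g), forall y,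
      exists j, [/\ j < k - l.+1, z y = u j & z' y = u' j]} ->
    {in free_vars g, forall y, exists j, [/\ j < k - l,
      upd z x a y = upd u (k - l.+1) a j & upd z' x a' y = upd u' (k - l.+1) a' j]}.
  move=> lk fv y yg; rewrite /upd; have [_|yx] := eqVneq y x.
    by exists (k - l.+1); rewrite eqxx; split=> //; lia.
  have [|j [jk -> ->]] := fv y; first by rewrite /= mem_filter yx.
  by exists j; rewrite ltn_eqF //; split=> //; lia.
elim: f i v w v' w' => [x y|x y|f IHf|f IHf g IHg|f IHf g IHg|f IHf g IHg|f IHf g IHg
  |x f IHf|x f IHf] i v w v' w' /andP[/= fi ik] vv' /= fv.
- have [|j [jk -> ->]] := fv x; first by rewrite !inE eqxx.
  have [|l [lk -> ->]] := fv y; first by rewrite !inE eqxx orbT.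
  by rewrite (agree_atoms ik vv').
- have [|j [jk -> ->]] := fv x; first by rewrite !inE eqxx.
  have [|l [lk -> ->]] := fv y; first by rewrite !inE eqxx orbT.
  by rewrite (agree_atoms ik vv').
- by congr negb; apply: IHf vv' fv; rewrite fi.
1-4: move: fi; rewrite geq_max => /andP[fi gi];
  by rewrite (IHf i v w v' w') ?(IHg i v w v' w') ?fi ?gi // => x xf;
     apply: fv; rewrite mem_cat xf ?orbT.
- case: i fi ik vv' fv => // i; rewrite ltnS => fi ik vv' fv.
  have IH a a' := IHf i (upd v (k - i.+1) a) (upd w x a)
    (upd v' (k - i.+1) a') (upd w' x a').
  have fi' : qdepth f <= i <= k by rewrite fi ltnW.
  apply/existsP/existsP => -[a sata].
    by have [a' uu'] := basis_back_forth a vv'; exists a'; rewrite -(IH a) //; apply: quant.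
  have [a' uu'] := basis_back_forth a (agree_sym vv'); exists a'.
  by rewrite (IH a' a) //; [apply: agree_sym | apply: quant].
- case: i fi ik vv' fv => // i; rewrite ltnS => fi ik vv' fv.
  have IH a a' := IHf i (upd v (k - i.+1) a) (upd w x a)
    (upd v' (k - i.+1) a') (upd w' x a').
  have fi' : qdepth f <= i <= k by rewrite fi ltnW.
  apply/forallP/forallP => sata a.
    have [a' uu'] := basis_back_forth a (agree_sym vv').
    by rewrite -(IH a' a) //; [apply: agree_sym | apply: quant].
  by have [a' uu'] := basis_back_forth a vv'; rewrite (IH a a') //; apply: quant.
Qed.

(** * Normal forms *)

Definition hintikka (k : nat) : seq formula := patterns (verum k) (basis k k).

(** Indexing by sets of positions makes normal forms countable as a power set. The final falsum
    gives even the empty disjunction depth [k]. *)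
Definition normal_form (k : nat) (S : {set 'I_(size (hintikka k))}) : formula :=
  foldr FOr (FNot (verum k))
    [seq nth (verum k) (hintikka k) (nat_of_ord i) | i <- enum S].

Lemma sat_normal_form (G : graph) k S (v : nat -> G) :
  sat (@normal_form k S) v = [exists i in S, sat (nth (verum k) (hintikka k) i) v].
Proof.
rewrite /normal_form; transitivity
  (has (fun i => sat (nth (verum k) (hintikka k) (nat_of_ord i)) v) (enum S)).
  by elim: (enum S) => [|i s IH] /=; rewrite ?sat_verum ?IH.
apply/hasP/exists_inP => -[i]; first by rewrite mem_enum; exists i.
by exists i; rewrite ?mem_enum.
Qed.

Lemma well_scoped_hintikka k : 0 < k -> {in hintikka k, forall t, well_scoped k 0 t}.
Proof.
move=> k0; rewrite -(subnn k); apply: well_scoped_patterns.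
  exact: well_scoped_verum.
exact: well_scoped_basis.
Qed.

Lemma normal_form_sentence k S :
  0 < k -> sentence (@normal_form k S) /\ qdepth (normal_form S) = k.
Proof.
move=> k0; rewrite /normal_form /sentence.
elim: (enum S) => [|i s [fs qs]] /=.
  by rewrite free_vars_verum qdepth_verum; case: k k0 S.
have /andP[ti] := well_scoped_hintikka k0 (mem_nth (verum k) (ltn_ord i)).
case: (free_vars _) => //= _; split=> //.
by rewrite qs; apply/maxn_idPr.
Qed.

Lemma flength_normal_form k S e :
  {in hintikka k, forall t, flength t <= e} ->
  flength (@normal_form k S) <= 2 ^ size (basis k k) * (e + 3) + (2 * k + 4).
Proof.
move=> he; have : size (enum S) <= 2 ^ size (basis k k).
  rewrite -(size_patterns (verum k)) -cardE -[leqRHS]card_ord; exact: max_card.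
move: (2 ^ _) => N /leq_trans; rewrite /normal_form.
suff : flength (foldr FOr (FNot (verum k))
                  [seq nth (verum k) (hintikka k) (nat_of_ord i) | i <- enum S])
       <= size (enum S) * (e + 3) + (2 * k + 4).
  by move=> H sN; apply: leq_trans H _; rewrite leq_add2r leq_mul2r sN // orbT.
elim: (enum S) => [|i s IH] /=; first by rewrite flength_verum; lia.
have ti : flength (nth (verum k) (hintikka k) i) <= e by apply: he; apply: mem_nth.
by apply: leq_trans (leq_add (leq_add (leqnn 3) ti) IH) _; move: (size s) => n; lia.
Qed.

(** Take the patterns that hold in some model of [Phi]: structures sharing a pattern of [basis k k]
    agree on [Phi]. *)
Lemma normal_form_exists k Phi :
  sentence Phi -> qdepth Phi = k -> exists S, equivalent Phi (@normal_form k S).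
Proof.
move=> sPhi qPhi; pose tau i := nth (verum k) (hintikka k) i.
have [b bP] : exists b : 'I_(size (hintikka k)) -> bool, forall i,
    b i <-> exists (G : graph) (v : nat -> G), sat (tau i) v /\ sat Phi v.
  apply: (@fin_all_exists _ (fun=> bool) (fun i c => is_true c <-> _)) => i.
  (* Joint satisfiability ranges over all graphs, so it is turned into a boolean classically. *)
  case: (classic (exists (G : graph) (v : nat -> G), sat (tau i) v /\ sat Phi v)) => h.
    by exists true; split.
  by exists false; split.
exists [set i | b i] => G; split=> mG v.
  have [t tH satt] := patterns_exist (basis k k) (sat_verum k v).
  rewrite -index_mem in tH; rewrite sat_normal_form; apply/exists_inP.
  exists (Ordinal tH); last by rewrite /= nth_index // -index_mem.
  by rewrite inE; apply/bP; exists G, v; rewrite /tau /= nth_index -?index_mem.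
have := mG v; rewrite sat_normal_form => /exists_inP[i]; rewrite inE.
case/bP=> [G' [v' [satt' satPhi']]] satt.
have vv' := patterns_agree (mem_nth (verum k) (ltn_ord i)) satt satt'.
by rewrite (agree_sat (w' := v') _ vv') ?qPhi ?leqnn // sPhi.
Qed.

(** * Sizes and lengths *)

Lemma size_pairs F k : size (pairs F k) = 'C(k, 2).
Proof.
rewrite size_allpairs_dep -bin2_sum (eq_map (g := id)) => [|x].
  by rewrite map_id sumnE /index_iota subn0.
exact: size_iota.
Qed.

Lemma bin2_double_le k : 'C(k, 2) + 'C(k, 2) <= 2 ^ k.
Proof.
case: k => [|[|[|k]]] //; elim: k => // k IH.
(* Passing from n to n + 1 adds n to C(n, 2), at most doubling it once n is at least 3. *)
rewrite binS bin1 expnS; have : k.+3 <= 'C(k.+3, 2); last by lia.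
by elim: {IH} k => // k IH; rewrite binS bin1; lia.
Qed.

Lemma leq_tower_logstar k : k <= tower (logstar k).
Proof. by rewrite /logstar; case: ex_minnP. Qed.

Lemma tower_mono : {homo tower : m n / m <= n}.
Proof.
move=> m n /subnK<-; elim: (n - m) => //= d IH; apply: leq_trans IH _.
exact/ltnW/ltn_expl.
Qed.

Lemma leq_exp_tower k i : 2 ^ k <= tower (logstar k + i).+1.
Proof.
apply: (@leq_trans (tower (logstar k).+1)); last by apply: tower_mono; lia.
by rewrite /= leq_exp2l // leq_tower_logstar.
Qed.

Lemma size_basis k i : size (basis k i) <= tower (logstar k + i).+1.
Proof.
elim: i => [|i IH]; last by rewrite /= size_map size_patterns addnS /= leq_exp2l.
rewrite size_cat !size_pairs; apply: leq_trans (bin2_double_le k) _.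
exact: leq_exp_tower.
Qed.

(** One round of the length recursion: at most [x] conjuncts of length at most [x ^ 2], with
    connectives, quantifier and [verum] in the lower terms. *)
Lemma cubic_leq_exp4 x : 4 <= x -> x ^ 3 + 5 * x + 5 <= (2 ^ x) ^ 2.
Proof.
move=> /subnK<-; elim: (x - 4) => // y IH.
by rewrite addSn; move: IH; rewrite [2 ^ _.+1]expnS; nia.
Qed.

Lemma cubic_ltn_exp2 x : 16 <= x -> x ^ 3 + 6 * x + 10 < 3 * 2 ^ x.
Proof.
move=> /subnK<-; elim: (x - 16) => [|y IH]; first by [].
by rewrite addSn; move: IH; rewrite [2 ^ _.+1]expnS; nia.
Qed.

Lemma double_leq_exp2 k : 2 * k <= 2 ^ k.
Proof. by case: k => // k; rewrite expnS leq_mul2l ltn_expl. Qed.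

Lemma flength_basis k i : 1 < k -> i <= k ->
  {in basis k i, forall b, flength b <= tower (logstar k + i).+1 ^ 2}.
Proof.
move=> k1; have k2 : 2 ^ 2 <= 2 ^ k by rewrite leq_exp2l.
elim: i => [_|i IH ik] b.
  have := leq_trans k2 (leq_exp_tower k 0); move: (tower _) => X X4.
  by rewrite mem_cat => /orP[] /pairsP[x [y [_ ->]]]; rewrite [flength _]/=; nia.
case/mapP=> t /(flength_patterns (IH (ltnW ik))) tB ->; move: tB.
rewrite flength_verum (addnS (logstar k)).
rewrite -[tower _.+2]/(2 ^ tower _.+1) [flength (FEx _ _)]/=.
have := leq_trans (double_leq_exp2 k) (leq_exp_tower k i).
have := cubic_leq_exp4 (leq_trans k2 (leq_exp_tower k i)).
have := size_basis k i.
move: (tower _) (size _) (flength t) => X s l; move: (2 ^ X) => N sX XN kX.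
by have := leq_mul sX (leqnn (X ^ 2 + 4)); lia.
Qed.

Lemma flength_normal_form_tower k S : 0 < k ->
  flength (@normal_form k S) < 3 * tower (k + logstar k + 2) ^ 2.
Proof.
rewrite addn2 (addnC k) leq_eqVlt => /predU1P[k1|k1].
  (* For [k = 1] the tower [X] used below is only 4, so the bound is computed: the two patterns have
     lengths 13 and 14. *)
  case: _ / k1 S => S; have h : {in hintikka 1, forall t, flength t <= 14}.
    by apply/allP.
  apply: leq_ltn_trans (flength_normal_form S h) _.
  have -> : logstar 1 = 0 by rewrite /logstar; case: ex_minnP => [[|n]] // _ /(_ 0 isT).
  by [].
have := flength_normal_form S (flength_patterns (flength_basis k1 (leqnn k))).
move/leq_ltn_trans; apply; rewrite flength_verum.
(* Here 16 is [tower 3], and [k] is at least 2. *)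
have X16 : 16 <= tower (logstar k + k).+1.
  by apply: (@tower_mono 3); lia.
have := cubic_ltn_exp2 X16.
have := leq_trans (double_leq_exp2 k) (leq_exp_tower k k).
have := size_basis k k.
rewrite -[tower _.+2]/(2 ^ tower _.+1).
move: (tower _) (size _) => X s sX kX XN.
have sN : 2 ^ s <= 2 ^ X by rewrite leq_exp2l.
have N1 : 0 < 2 ^ X by rewrite expn_gt0.
have := leq_mul sX (leqnn (X ^ 2 + 4)).
move: (2 ^ s) (2 ^ X) sN N1 XN => A N AN N1 XN sX'.
(* [Z] bounds a disjunct with its [FOr]. The slack [2 * k + 5] strictly covers the final falsum, of
   length [2 * k + 4]. *)
set Z := s * (X ^ 2 + 4) + (2 * k + 3) + 3.
have ZN : Z + (2 * k + 5) <= 3 * N by rewrite /Z; lia.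
have := leq_mul AN (leqnn Z); have := leq_mul (leqnn N) ZN.
have := leq_mul N1 (leqnn (2 * k + 5)).
by move: Z {ZN} => Z; lia.
Qed.

(** * Counting normal forms and bounding their length *)

Theorem theorem2p4 (k : nat) (hk : 0 < k) :
  (forall (m : nat) (Phi : 'I_m -> formula),
     (forall i, sentence (Phi i) /\ qdepth (Phi i) = k) ->
     (forall i j, i <> j -> ~ equivalent (Phi i) (Phi j)) ->
     m <= tower (k + logstar k + 3))
  /\
  (forall Phi : formula, sentence Phi -> qdepth Phi = k ->
     exists Phi' : formula,
       [/\ sentence Phi', equivalent Phi Phi', qdepth Phi' = k
         & flength Phi' < 3 * tower (k + logstar k + 2) ^ 2]).
Proof.
split=> [m Phi PhiP Phi_neq | Phi sPhi qPhi]; last first.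
  have [S eqS] := normal_form_exists sPhi qPhi.
  have [sS qS] := normal_form_sentence S hk.
  by exists (normal_form S); split=> //; apply: flength_normal_form_tower.
have [S SP] : exists S : 'I_m -> {set 'I_(size (hintikka k))},
    forall i, equivalent (Phi i) (normal_form (S i)).
  apply: (@fin_all_exists _ (fun=> {set 'I_(size (hintikka k))})
    (fun i S => equivalent (Phi i) (normal_form S))) => i.
  by have [] := PhiP i; apply: normal_form_exists.
(* Equal index sets would make two of the sentences equivalent, so [m] is at most the number of
   index sets. *)
have S_inj : injective S.
  move=> i j Sij; apply: NNPP => /Phi_neq; apply => G.
  by rewrite (SP i G) (SP j G) Sij.
have := leq_card S S_inj.
rewrite card_ord -cardsT -powersetT card_powerset cardsT card_ord.
(* Patterns and then sets of patterns each exponentiate the size of [basis k k]: two more tower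
   levels. *)
move/leq_trans; apply; rewrite size_patterns addn3 (addnC k).
by rewrite /= !leq_exp2l //; apply: size_basis.
Qed.
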